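(* Let $d\ge2$ and $a\in\mathbb{B}\setminus\{0\}$. The inversion $I_a$ leaves $\overline{\mathbb{B}}$ invariant, that is, $I_a(\mathbb{B})=\mathbb{B}$ and $I_a(\partial\mathbb{B})=\partial\mathbb{B}$. In particular, $$I_a|_{\partial\mathbb{B}}(x)=(\mathrm{id}-2P_{x-\hat a})x,\qquad x\in\partial\mathbb{B},$$ where $P_y$ denotes the orthogonal projection onto the line spanned by $y\in\mathbb{R}^d\setminus\{0\}$. The following two items completely characterize how a concentric ball embedded in $\mathbb{B}$ is deformed under a given $I_a$, as well as which $I_a$ maps a given ball embedded in $\mathbb{B}$ to a concentric one: (i) Let $r\in(0,1)$ and $a=\rho e_a$ with $\rho\in(0,1)$ and $e_a\in\partial\mathbb{B}$. Then $I_a(B(0,r))=B(C,R)$ and $I_a(S(0,r))=S(C,R)$ with $$C=\frac{\rho(r^2-1)}{\rho^2r^2-1}e_a,\qquad R=\frac{r(\rho^2-1)}{\rho^2r^2-1}.$$ (ii) Let $R\in(0,1-c)$ and $C=ce_a$ with $c\in(0,1)$ and $e_a\in\partial\mathbb{B}$. Then $I_a(B(C,R))=B(0,r)$ and $I_a(S(C,R))=S(0,r)$ with $$r=\frac{1+R^2-c^2-\sqrt{((1-R)^2-c^2)((1+R)^2-c^2)}}{2R},\qquad a=\frac{C}{1-Rr}.$$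
   Context: $d\ge2$ is an integer. $B(x_0,t)$ and $S(x_0,t)=\partial B(x_0,t)$ denote the open Euclidean ball and the sphere in $\mathbb{R}^d$ with center $x_0$ and radius $t>0$; $\mathbb{B}=B(0,1)$. For $a\in\mathbb{B}\setminus\{0\}$ put $\rho=|a|$, $e_a=a/|a|$, $\hat a=a/|a|^2$, $b=(\rho^{-2}-1)^{1/2}$. The inversion $I_a$ (in the sphere $S(\hat a,b)$) is $$I_a(x)=b^2\frac{x-\hat a}{|x-\hat a|^2}+\hat a,\qquad x\in\mathbb{R}^d\setminus\{\hat a\}.$$ *)

(* Defs.v *)
From mathcomp Require Import all_boot all_order all_algebra.
From mathcomp Require Import boolp classical_sets reals.

Set Implicit Arguments.
Unset Strict Implicit.
Unset Printing Implicit Defensive.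

Import Order.TTheory GRing.Theory Num.Theory.
Local Open Scope classical_set_scope.
Local Open Scope ring_scope.

Section Inversion.
Context {R : realType} {d : nat}.
Implicit Types (x y p a : 'rV[R]_d) (t : R).

Definition dotp x y : R := \sum_(i < d) x 0 i * y 0 i.

(* The norm that the library puts on matrices is the sup norm, hence a
   separate Euclidean one. *)
Definition enorm x : R := Num.sqrt (dotp x x).

Definition oball x t : set 'rV[R]_d := [set y | enorm (y - x) < t].
Definition cball x t : set 'rV[R]_d := [set y | enorm (y - x) <= t].
Definition sphere x t : set 'rV[R]_d := [set y | enorm (y - x) = t].

Definition inv_center a : 'rV[R]_d := (enorm a ^+ 2)^-1 *: a.
Definition inv_radius a : R := Num.sqrt ((enorm a ^+ 2)^-1 - 1).

(* Total function: at its pole [inv_center a], where the inversion is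
   undefined, it takes the value [inv_center a]. The pole lies outside the
   closed unit ball when 0 < |a| < 1. *)
Definition inversion a x : 'rV[R]_d :=
  (inv_radius a ^+ 2 / enorm (x - inv_center a) ^+ 2) *: (x - inv_center a)
  + inv_center a.

(* Orthogonal projection of x onto the line spanned by y (for y != 0),
   characterized by [line_projP]. *)
Definition line_proj y x : 'rV[R]_d := (dotp x y / dotp y y) *: y.

Lemma dotp_eq0 y : (dotp y y == 0) = (y == 0).
Proof.
apply/eqP/eqP => [|->]; last by rewrite /dotp big1 // => i _; rewrite mxE mul0r.
move/eqP; rewrite /dotp psumr_eq0; last by move=> i _; rewrite -expr2 sqr_ge0.
move/allP => h; apply/rowP => i; rewrite mxE.
by have := h i (mem_index_enum i); rewrite /= mulf_eq0 orbb => /eqP.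
Qed.

Lemma dotpBZl x y t : dotp (x - t *: y) y = dotp x y - t * dotp y y.
Proof.
rewrite /dotp mulr_sumr -sumrB; apply: eq_bigr => i _.
by rewrite !mxE mulrBl mulrA.
Qed.

Lemma line_projP y x p : y != 0 ->
  p = line_proj y x <-> (exists t, p = t *: y) /\ dotp (x - p) y = 0.
Proof.
rewrite -dotp_eq0 => y0; split=> [->|[[t ->]]].
  by split; [exists (dotp x y / dotp y y) | rewrite dotpBZl divfK ?subrr].
by rewrite dotpBZl => /eqP; rewrite subr_eq0 /line_proj => /eqP ->; rewrite mulfK.
Qed.

End Inversion.

(* Main.v *)
Require Import Defs.
From mathcomp Require Import all_boot all_order all_algebra.
From mathcomp Require Import boolp classical_sets reals.
From mathcomp Require Import ring lra.

Set Implicit Arguments.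
Unset Strict Implicit.
Unset Printing Implicit Defensive.

Import Order.TTheory GRing.Theory Num.Theory.
Local Open Scope classical_set_scope.
Local Open Scope ring_scope.

(** Everything rests on one identity. Write [s = |a|^2], so that the pole is
    [a / s] and the squared radius of inversion is [1 / s - 1]. For
    [s r^2 < 1], multiplying [|I_a y|^2 - r^2] by the squared distance from
    [y] to the pole gives a quadratic function of [y] with leading coefficient
    [1 / s - r^2 > 0], and completing the square turns it into
    [(1 / s - r^2) (|y - C|^2 - t^2)], where

      [C = (1 - r^2) / (1 - s r^2) a]  and  [t = r (1 - s) / (1 - s r^2)].

    Hence [|I_a y|^2 - r^2] and [|y - C|^2 - t^2] have the same sign
    ([sgr_inversion]): the preimage of the ball or sphere of radius [r] about 0
    is the ball or sphere of radius [t] about [C]. As [I_a] is an involution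
    ([inversionK]), preimages are images. The radius [r = 1] gives [C = 0] and
    [t = 1], which is the invariance of the unit ball, and [r < 1] gives the
    image of a concentric ball. The reflection formula on the unit sphere is a
    direct computation from [|x - a / s|^2 - 2 <x, x - a / s> = 1 / s - 1].

    For the converse problem, the formulas for [c] and [t] in terms of [rho]
    and [r] are solved by eliminating [rho]: since
    [1 - t r = (1 - r^2) / (1 - rho^2 r^2)], one gets [rho = c / (1 - t r)] and
    [t r^2 - (1 + t^2 - c^2) r + t = 0] ([inversion_parametersP]). This
    equation is palindromic, so its roots are inverse to each other and exactly
    one of them is in (0, 1), namely the one with the minus sign before the
    square root. Uniqueness of [a] and [r] then follows because a ball
    determines its centre and its radius ([oball_inj]). *)

(** * Euclidean norm and balls *)

Section EuclideanNorm.
Context {R : realType} {d : nat}.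
Implicit Types (x y z : 'rV[R]_d) (k t : R).

Lemma dotpC x y : dotp x y = dotp y x.
Proof. by apply: eq_bigr => i _; rewrite mulrC. Qed.

Lemma dotpDl x y z : dotp (x + y) z = dotp x z + dotp y z.
Proof. by rewrite /dotp -big_split; apply: eq_bigr => i _; rewrite mxE mulrDl. Qed.

Lemma dotpZl k x y : dotp (k *: x) y = k * dotp x y.
Proof. by rewrite /dotp mulr_sumr; apply: eq_bigr => i _; rewrite mxE mulrA. Qed.

Lemma dotpDr x y z : dotp z (x + y) = dotp z x + dotp z y.
Proof. by rewrite dotpC dotpDl !(dotpC z). Qed.

Lemma dotpZr k x y : dotp x (k *: y) = k * dotp x y.
Proof. by rewrite dotpC dotpZl dotpC. Qed.

Lemma dotpNl x y : dotp (- x) y = - dotp x y.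
Proof. by rewrite -scaleN1r dotpZl mulN1r. Qed.

Lemma dotpNr x y : dotp x (- y) = - dotp x y.
Proof. by rewrite dotpC dotpNl dotpC. Qed.

Definition dotpE := (dotpDl, dotpDr, dotpNl, dotpNr, dotpZl, dotpZr).

Lemma dotp_ge0 x : 0 <= dotp x x.
Proof. by apply: sumr_ge0 => i _; rewrite -expr2 sqr_ge0. Qed.

Lemma enorm_ge0 x : 0 <= enorm x.
Proof. exact: sqrtr_ge0. Qed.

Lemma sqr_enorm x : enorm x ^+ 2 = dotp x x.
Proof. by rewrite sqr_sqrtr ?dotp_ge0. Qed.

Lemma enorm_eq0 x : (enorm x == 0) = (x == 0).
Proof. by rewrite -dotp_eq0 -sqr_enorm sqrf_eq0. Qed.

Lemma enormZ k x : enorm (k *: x) = `|k| * enorm x.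
Proof. by rewrite /enorm !dotpE mulrA -expr2 sqrtrM ?sqr_ge0 // sqrtr_sqr. Qed.

Lemma sgr_enorm_lt x t : 0 <= t ->
  (enorm x < t) = (Num.sg (dotp x x - t ^+ 2) < 0).
Proof. by move=> t0; rewrite sgr_lt0 subr_lt0 -sqr_enorm ltr_sqr ?nnegrE ?enorm_ge0. Qed.

Lemma sgr_enorm_eq x t : 0 <= t ->
  (enorm x == t) = (Num.sg (dotp x x - t ^+ 2) == 0).
Proof. by move=> t0; rewrite sgr_eq0 subr_eq0 -sqr_enorm eqrXn2 ?enorm_ge0. Qed.

(** The point of the smaller ball farthest from [y] lies on the ray from [y]
    through [x]; the unit vector [e] supplies a direction when [x = y]. *)
Lemma oball_sub_radius (e x y : 'rV[R]_d) (s t : R) :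
  enorm e = 1 -> 0 < s -> oball x s `<=` oball y t -> enorm (x - y) + s <= t.
Proof.
move=> e1 s0 sub.
have [u u1 xyE] : exists2 u, enorm u = 1 & x - y = enorm (x - y) *: u.
  have [->|xy] := eqVneq x y.
    have n0 : enorm (y - y) = 0 by apply/eqP; rewrite enorm_eq0 subrr.
    by exists e; rewrite // n0 subrr scale0r.
  have n0 : enorm (x - y) != 0 by rewrite enorm_eq0 subr_eq0.
  exists ((enorm (x - y))^-1 *: (x - y)); last by rewrite scalerA divff // scale1r.
  by rewrite enormZ ger0_norm ?invr_ge0 ?enorm_ge0 // mulVf.
have ray k : 0 <= k < s -> enorm (x - y) + k < t.
  case/andP=> k0 ks; have /sub : oball x s (x + k *: u).
    by rewrite /oball /= addrC addKr enormZ u1 mulr1 ger0_norm.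
  rewrite /oball /= addrAC {1}xyE -scalerDl enormZ u1 mulr1 ger0_norm //.
  by rewrite addr_ge0 ?enorm_ge0.
have := ray 0; rewrite lexx s0 addr0 => /(_ isT) xyt.
rewrite leNgt; apply/negP => h.
have kB : 0 <= t - enorm (x - y) < s by apply/andP; split; lra.
by have := ray _ kB; rewrite subrKC ltxx.
Qed.

Lemma oball_inj (e x y : 'rV[R]_d) (s t : R) :
  enorm e = 1 -> 0 < s -> 0 < t -> oball x s = oball y t -> x = y /\ s = t.
Proof.
move=> e1 s0 t0 E.
have h1 : enorm (x - y) + s <= t by apply: (oball_sub_radius e1 s0); rewrite E.
have h2 : enorm (y - x) + t <= s by apply: (oball_sub_radius e1 t0); rewrite E.
have n1 := enorm_ge0 (x - y); have n2 := enorm_ge0 (y - x).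
split; last by lra.
by apply/eqP; rewrite -subr_eq0 -enorm_eq0; apply/eqP; lra.
Qed.

End EuclideanNorm.

(** * Inversions preserving the unit ball *)

Section InvolutionImages.
Variables (T : Type) (f : T -> T).
Hypothesis fK : involutive f.

Lemma image_involutive (A : set T) : f @` A = f @^-1` A.
Proof.
apply/seteqP; split=> [_ [x Ax <-]|y Ay]; first by rewrite /preimage /= fK.
by exists (f y).
Qed.

Lemma image_involutive_swap (A B : set T) : f @` A = B -> f @` B = A.
Proof.
by move=> <-; rewrite image_comp -[RHS]image_id; apply: eq_imagel => x _; apply: fK.
Qed.

End InvolutionImages.

Section UnitBallInversion.
Context {R : realType} {d : nat}.
Variable a : 'rV[R]_d.
Hypotheses (a_in : oball 0 1 a) (a_neq0 : a != 0).
Implicit Types (x y : 'rV[R]_d) (r : R).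

Let s : R := dotp a a.

Let s_gt0 : 0 < s.
Proof. by rewrite lt_def dotp_ge0 dotp_eq0 a_neq0. Qed.

Let s_lt1 : s < 1.
Proof. by move: a_in; rewrite /oball /= subr0 /s -sqr_enorm expr_lt1 ?enorm_ge0. Qed.

Lemma sqr_inv_radius : inv_radius a ^+ 2 = s^-1 - 1.
Proof.
by rewrite /inv_radius sqr_enorm sqr_sqrtr // subr_ge0 invf_ge1 // ltW.
Qed.

Lemma inversion_pole : inversion a (inv_center a) = inv_center a.
Proof. by rewrite /inversion subrr scaler0 add0r. Qed.

Lemma inversionE x : inversion a x =
  ((s^-1 - 1) / dotp (x - s^-1 *: a) (x - s^-1 *: a)) *: (x - s^-1 *: a) + s^-1 *: a.
Proof. by rewrite /inversion sqr_inv_radius /inv_center !sqr_enorm. Qed.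

(** This includes the pole, which the total function [inversion a] fixes. *)
Lemma inversionK : involutive (inversion a).
Proof.
move=> x; rewrite [in LHS]inversionE (inversionE x) addrK.
rewrite -[RHS](subrK (s^-1 *: a)); move: (x - _) => u.
have [->|u0] := eqVneq u 0; first by rewrite !scaler0.
have N0 : dotp u u != 0 by rewrite dotp_eq0.
have s1 : 1 - s != 0 by rewrite subr_eq0 eq_sym lt_eqF.
rewrite !dotpE scalerA -[u in RHS]scale1r; congr (_ *: _ + _); field.
by rewrite N0 mulN1r s1 lt0r_neq0.
Qed.

(** Away from the pole the two sides differ by the positive factor
    [(1 - s r^2) / (s |u|^2)] with [u = y - a / s], as [y - C] is
    [u + (1 - s) / (s (1 - s r^2)) a]. At the pole both sides are positive,
    since [s r^2 < 1] puts the pole outside both balls. *)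
Lemma sgr_inversion r y : s * r ^+ 2 < 1 ->
  let C := ((1 - r ^+ 2) / (1 - s * r ^+ 2)) *: a in
  let t := r * (1 - s) / (1 - s * r ^+ 2) in
  Num.sg (dotp (inversion a y) (inversion a y) - r ^+ 2)
  = Num.sg (dotp (y - C) (y - C) - t ^+ 2).
Proof.
move=> sr C t.
have k0 : 0 < 1 - s * r ^+ 2 by rewrite subr_gt0.
have s0 := lt0r_neq0 s_gt0; have k1 := lt0r_neq0 k0.
have [->|y0] := eqVneq y (inv_center a).
  rewrite inversion_pole /inv_center sqr_enorm -/s /C !dotpE -/s !gtr0_sg //.
    rewrite [ltRHS](_ : _ = ((1 - s) / (1 - s * r ^+ 2)) ^+ 2 * ((1 - s * r ^+ 2) / s)).
      by rewrite mulr_gt0 ?divr_gt0 // exprn_gt0 // divr_gt0 // subr_gt0.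
    by rewrite /t; field; apply/andP.
  rewrite [ltRHS](_ : _ = (1 - s * r ^+ 2) / s); first by rewrite divr_gt0.
  by field.
have CE : y - C = (y - s^-1 *: a) + ((1 - s) / (s * (1 - s * r ^+ 2))) *: a.
  rewrite /C -addrA; congr (_ + _); rewrite -!scaleNr -scalerDl; congr (_ *: _).
  by field; apply/andP.
have u0 : y - s^-1 *: a != 0.
  by move: y0; rewrite subr_eq0 /inv_center sqr_enorm.
rewrite inversionE CE; move: (y - _) u0 => u u0.
have N0 : 0 < dotp u u by rewrite lt_def dotp_ge0 dotp_eq0 u0.
rewrite !dotpE (dotpC a u) -/s.
set L := (X in Num.sg X = _); set M := (X in _ = Num.sg X).
have -> : L = (1 - s * r ^+ 2) / (s * dotp u u) * M.
  by rewrite /L /M /t; field; rewrite s0 ?lt0r_neq0 //= mulN1r.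
by rewrite sgrM gtr0_sg ?mul1r // divr_gt0 // mulr_gt0.
Qed.

Lemma inversion_oball r : 0 <= r -> s * r ^+ 2 < 1 ->
  inversion a @` oball 0 r =
  oball (((1 - r ^+ 2) / (1 - s * r ^+ 2)) *: a) (r * (1 - s) / (1 - s * r ^+ 2)).
Proof.
move=> r0 sr; rewrite (image_involutive inversionK).
have t0 : 0 <= r * (1 - s) / (1 - s * r ^+ 2) by rewrite divr_ge0 ?mulr_ge0 // subr_ge0 ltW.
apply/funext => y; apply/propext.
by rewrite /oball /preimage /= subr0 !sgr_enorm_lt // sgr_inversion.
Qed.

Lemma inversion_sphere r : 0 <= r -> s * r ^+ 2 < 1 ->
  inversion a @` sphere 0 r =
  sphere (((1 - r ^+ 2) / (1 - s * r ^+ 2)) *: a) (r * (1 - s) / (1 - s * r ^+ 2)).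
Proof.
move=> r0 sr; rewrite (image_involutive inversionK).
have t0 : 0 <= r * (1 - s) / (1 - s * r ^+ 2) by rewrite divr_ge0 ?mulr_ge0 // subr_ge0 ltW.
apply/funext => y; apply/propext; rewrite /sphere /preimage /= subr0.
by split=> /eqP h; apply/eqP; move: h; rewrite !sgr_enorm_eq // sgr_inversion.
Qed.

Lemma inversion_unit_oball : inversion a @` oball 0 1 = oball 0 1.
Proof.
rewrite inversion_oball ?ler01 ?expr1n ?mulr1 // subrr mul0r scale0r mul1r divff //.
by rewrite lt0r_neq0 // subr_gt0.
Qed.

Lemma inversion_unit_sphere : inversion a @` sphere 0 1 = sphere 0 1.
Proof.
rewrite inversion_sphere ?ler01 ?expr1n ?mulr1 // subrr mul0r scale0r mul1r divff //.
by rewrite lt0r_neq0 // subr_gt0.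
Qed.

Lemma inversion_unit_cball : inversion a @` cball 0 1 = cball 0 1.
Proof.
have -> : cball 0 1 = oball 0 1 `|` sphere 0 1 :> set 'rV[R]_d.
  apply/seteqP; split=> x; rewrite /cball /oball /sphere /= le_eqVlt.
    by case/orP=> [/eqP|]; [right|left].
  by case=> [->|->]; rewrite ?eqxx ?orbT.
by rewrite image_setU inversion_unit_oball inversion_unit_sphere.
Qed.

Lemma inversion_unit_sphereE x : sphere 0 1 x ->
  inversion a x = x - 2 *: line_proj (x - inv_center a) x.
Proof.
rewrite /sphere /= subr0 => x1.
have xx : dotp x x = 1 by rewrite -sqr_enorm x1 expr1n.
rewrite inversionE /line_proj /inv_center sqr_enorm -/s.
set u := x - _.
have N0 : dotp u u != 0.
  rewrite dotp_eq0 subr_eq0; apply/eqP => xE; move: xx; rewrite xE !dotpE -/s.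
  move=> /eqP; rewrite mulVf ?lt0r_neq0 // mulr1 invr_eq1 => /eqP s1.
  by move: s_lt1; rewrite s1 ltxx.
have -> : s^-1 *: a = x - u by rewrite /u subKr.
rewrite scalerA addrCA -scaleNr -(scaleN1r u) -scalerDl; congr (_ + _ *: _).
have -> : s^-1 - 1 = dotp u u - 2 * dotp x u.
  by rewrite /u !dotpE -/s xx (dotpC a x); field; rewrite lt0r_neq0.
by field.
Qed.

End UnitBallInversion.

(** * The parameters of a ball and of its image *)

Section BallParameters.
Variable R : realType.
Implicit Types (c t r rho : R).

Lemma sqrM_lt1 (x y : R) : 0 < x < 1 -> 0 < y < 1 -> x ^+ 2 * y ^+ 2 < 1.
Proof.
move=> /andP[x0 x1] /andP[y0 y1].
have [xl yl] := (ltW x0, ltW y0).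
by rewrite -exprMn expr_lt1 ?mulr_ilt1 ?mulr_ge0.
Qed.

(** Both directions rest on [1 - t r = (1 - r^2) / (1 - rho^2 r^2)]. It makes the
    first formula read [c = rho (1 - t r)], and [t] gives
    [r - t = r rho^2 (1 - t r)]; eliminating [rho] leaves
    [(r - t) (1 - t r) = c^2 r], which is the quadratic equation. *)
Lemma inversion_parametersP c t r rho : 0 < c -> 0 < t < 1 -> 0 < r < 1 ->
  [/\ 0 < rho < 1, c = rho * (r ^+ 2 - 1) / (rho ^+ 2 * r ^+ 2 - 1)
    & t = r * (rho ^+ 2 - 1) / (rho ^+ 2 * r ^+ 2 - 1)] <->
  t * r ^+ 2 - (1 + t ^+ 2 - c ^+ 2) * r + t = 0 /\ rho = c / (1 - t * r).
Proof.
move=> c0 /andP[t0 t1] /andP[r0 r1].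
have tr1 : 0 < 1 - t * r by nra.
have rr1 : 0 < 1 - r ^+ 2 by nra.
split=> [[/andP[p0 p1] cE tE]|[E pE]].
  have k : rho ^+ 2 * r ^+ 2 - 1 != 0.
    by rewrite subr_eq0 lt_eqF // sqrM_lt1 ?p0 ?r0.
  split; first by rewrite cE tE; field; rewrite exprMn.
  have trE : 1 - t * r = (r ^+ 2 - 1) / (rho ^+ 2 * r ^+ 2 - 1).
    by rewrite tE; field; rewrite exprMn.
  rewrite trE cE; field.
  by rewrite exprMn k /= subr_eq0 lt_eqF // expr_lt1 // ltW.
have cc : c ^+ 2 = (r - t) * (1 - t * r) / r.
  have -> : (r - t) * (1 - t * r) = c ^+ 2 * r by lra.
  by rewrite mulfK // lt0r_neq0.
have nz := (lt0r_neq0 r0, lt0r_neq0 tr1, lt0r_neq0 rr1).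
have pp : rho ^+ 2 = (r - t) / (r * (1 - t * r)).
  by rewrite pE expr_div_n cc; field; rewrite !nz.
have p0 : 0 < rho by rewrite pE divr_gt0.
have k : rho ^+ 2 * r ^+ 2 - 1 = (r ^+ 2 - 1) / (1 - t * r).
  by rewrite pp; field; rewrite !nz.
have nz' : r ^+ 2 - 1 != 0 by rewrite -oppr_eq0 opprB nz.
split.
- rewrite p0 -(expr_lt1 (n := 2)) ?ltW // -subr_gt0 pp.
  have -> : 1 - (r - t) / (r * (1 - t * r)) = t * (1 - r ^+ 2) / (r * (1 - t * r)).
    by field; rewrite !nz.
  by rewrite divr_gt0 // mulr_gt0.
- by rewrite k pE; field; rewrite !nz.
- by rewrite k pp; field; rewrite !nz nz'.
Qed.

(** With [B = 1 + t^2 - c^2] the number under the root is the discriminant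
    [B^2 - (2 t)^2]; the bound [t < 1 - c] says that [B > 2 t], which makes the
    smaller root positive and less than 1. *)
Lemma inversion_radius_root c t : 0 < c < 1 -> 0 < t < 1 - c ->
  let r := (1 + t ^+ 2 - c ^+ 2
            - Num.sqrt (((1 - t) ^+ 2 - c ^+ 2) * ((1 + t) ^+ 2 - c ^+ 2)))
           / (2 * t) in
  0 < r < 1 /\ t * r ^+ 2 - (1 + t ^+ 2 - c ^+ 2) * r + t = 0.
Proof.
move=> /andP[c0 c1] /andP[t0 t1].
set B := 1 + t ^+ 2 - c ^+ 2.
have -> : (1 - t) ^+ 2 - c ^+ 2 = B - 2 * t by rewrite /B; ring.
have -> : (1 + t) ^+ 2 - c ^+ 2 = B + 2 * t by rewrite /B; ring.
have B0 : 0 < B - 2 * t by rewrite /B; nra.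
clearbody B.
have D0 : 0 <= (B - 2 * t) * (B + 2 * t) by rewrite mulr_ge0 //; lra.
set S := Num.sqrt _ => r.
have SS : S ^+ 2 = (B - 2 * t) * (B + 2 * t) by rewrite sqr_sqrtr.
have S0 : 0 <= S by rewrite sqrtr_ge0.
clearbody S; split.
  by rewrite /r divr_gt0 ?ltr_pdivrMr ?mul1r //; nra.
have -> : t * r ^+ 2 - B * r + t = (S ^+ 2 - (B - 2 * t) * (B + 2 * t)) / (4 * t).
  by rewrite /r; field; rewrite lt0r_neq0.
by rewrite SS subrr mul0r.
Qed.

(** The product of the two roots is 1, so they cannot both be in (0, 1). *)
Lemma palindromic_root_uniq (A B r1 r2 : R) : A != 0 -> 0 < r1 < 1 -> 0 < r2 < 1 ->
  A * r1 ^+ 2 - B * r1 + A = 0 -> A * r2 ^+ 2 - B * r2 + A = 0 -> r1 = r2.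
Proof.
move=> A0 /andP[p1 l1] /andP[p2 l2] E1 E2.
have /eqP : A * (r1 - r2) * (1 - r1 * r2) = 0.
  have -> : A * (r1 - r2) * (1 - r1 * r2) =
    r1 * (A * r2 ^+ 2 - B * r2 + A) - r2 * (A * r1 ^+ 2 - B * r1 + A) by ring.
  by rewrite E1 E2 !mulr0 subrr.
rewrite !mulf_eq0 (negPf A0) /= => /orP[|/eqP h]; first by rewrite subr_eq0 => /eqP.
by exfalso; nra.
Qed.

End BallParameters.

(** * Images of concentric balls and their uniqueness *)

Section ConcentricBalls.
Context {R : realType} {d : nat}.
Implicit Types (e : 'rV[R]_d) (c t r rho : R).

Lemma ray_in_unit_oball rho e : 0 < rho < 1 -> sphere 0 1 e ->
  oball 0 1 (rho *: e) /\ rho *: e != 0.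
Proof.
rewrite /sphere /oball /= !subr0 => /andP[p0 p1] e1.
by rewrite -enorm_eq0 enormZ e1 mulr1 gtr0_norm // lt0r_neq0.
Qed.

Lemma inversion_concentric r rho e :
  0 < r < 1 -> 0 < rho < 1 -> sphere 0 1 e ->
  let a := rho *: e in
  let C := (rho * (r ^+ 2 - 1) / (rho ^+ 2 * r ^+ 2 - 1)) *: e in
  let t := r * (rho ^+ 2 - 1) / (rho ^+ 2 * r ^+ 2 - 1) in
  [/\ 0 < t, inversion a @` oball 0 r = oball C t
    & inversion a @` sphere 0 r = sphere C t].
Proof.
move=> /andP[r0 r1] p01 se a C t; have /andP[p0 p1] := p01.
have [a1 a0] : oball 0 1 a /\ a != 0 by apply: ray_in_unit_oball.
have s : dotp a a = rho ^+ 2.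
  by rewrite -sqr_enorm enormZ; move: se; rewrite /sphere /= subr0 => ->; rewrite mulr1 gtr0_norm.
have k : rho ^+ 2 * r ^+ 2 < 1 by apply: sqrM_lt1 => //; apply/andP.
have k' : rho ^+ 2 * r ^+ 2 - 1 != 0 by rewrite subr_eq0 lt_eqF.
have k'' : 1 - rho ^+ 2 * r ^+ 2 != 0 by rewrite -oppr_eq0 opprB.
have CE : C = ((1 - r ^+ 2) / (1 - dotp a a * r ^+ 2)) *: a.
  by rewrite /C /a s scalerA; congr (_ *: _); field; rewrite exprMn k' k''.
have tE : t = r * (1 - dotp a a) / (1 - dotp a a * r ^+ 2).
  by rewrite /t s; field; rewrite exprMn k' k''.
split.
- by rewrite tE s divr_gt0 ?subr_gt0 ?mulr_gt0 ?subr_gt0 // expr_lt1 // ltW.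
- by rewrite CE tE inversion_oball ?s // ltW.
- by rewrite CE tE inversion_sphere ?s // ltW.
Qed.

(** The inversion swaps the two balls, so the image of the concentric ball is
    [oball (c *: e) t]; comparing centres and radii with the known image of a
    concentric ball puts [|a'|] and [r'] in the system solved by
    [inversion_parametersP]. *)
Lemma inversion_to_concentric_uniq c t r rho e (a' : 'rV[R]_d) r' :
  0 < c < 1 -> 0 < t < 1 - c -> sphere 0 1 e ->
  0 < r < 1 -> t * r ^+ 2 - (1 + t ^+ 2 - c ^+ 2) * r + t = 0 ->
  rho = c / (1 - t * r) ->
  oball 0 1 a' -> a' != 0 -> 0 < r' ->
  inversion a' @` oball (c *: e) t = oball 0 r' -> a' = rho *: e /\ r' = r.
Proof.
move=> /andP[c0 c1] /andP[t0 t1] se r01 Er rhoE a1 a0 r'0 im.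
have e1 : enorm e = 1 by move: se; rewrite /sphere /= subr0.
have im' : inversion a' @` oball 0 r' = oball (c *: e) t.
  by apply: image_involutive_swap im; apply: inversionK.
(* Otherwise the concentric ball contains the invariant unit ball, so its image,
   of radius [t < 1], would contain the unit ball too. *)
have r'1 : r' < 1.
  rewrite ltNge; apply/negP => r'1.
  have : oball 0 1 `<=` oball (c *: e) t.
    rewrite -im' -(inversion_unit_oball a1 a0); apply: image_subset => x.
    by rewrite /oball /= => /lt_le_trans; apply.
  move/(oball_sub_radius e1 ltr01); have := enorm_ge0 (0 - c *: e); lra.
set rho' := enorm a'; have n0 : rho' != 0 by rewrite enorm_eq0.
pose e' := rho'^-1 *: a'.
have aE : a' = rho' *: e' by rewrite scalerA divff // scale1r.
have p01 : 0 < rho' < 1.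
  by rewrite lt_def n0 enorm_ge0; move: a1; rewrite /oball /= subr0.
have e'1 : enorm e' = 1 by rewrite enormZ ger0_norm ?mulVf // invr_ge0 enorm_ge0.
clearbody e'; have se' : sphere 0 1 e' by rewrite /sphere /= subr0.
have r'01 : 0 < r' < 1 by rewrite r'0.
have [t'0 imE _] := inversion_concentric r'01 p01 se'.
move: imE; rewrite -aE im' => /(oball_inj e1 t0 t'0)[].
set c' := rho' * _ / _ => cE tE.
have c'0 : 0 < c'.
  have /andP[p0 p1] := p01.
  by rewrite /c' -mulrA mulr_gt0 // -mulrNN -invrN !opprB divr_gt0 // subr_gt0
             ?sqrM_lt1 ?expr_lt1 // ltW.
have cc' : c = c'.
  by have := congr1 enorm cE; rewrite !enormZ e1 e'1 !mulr1 !gtr0_norm.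
have ee' : e = e'.
  by apply: (scalerI (lt0r_neq0 c0)); rewrite cE cc'.
have t01 : 0 < t < 1 by rewrite t0; lra.
have [Er' pE] := (inversion_parametersP rho' c0 t01 r'01).1 (And3 p01 cc' tE).
have r'r : r' = r by apply: palindromic_root_uniq Er' Er; rewrite ?lt0r_neq0.
by split=> //; rewrite aE ee' pE rhoE r'r.
Qed.

End ConcentricBalls.

(** * The theorem *)

Theorem theorem2p6 (R : realType) (d : nat) (hd : (2 <= d)%N) :
  (forall a : 'rV[R]_d, oball 0 1 a -> a != 0 ->
     [/\ inversion a @` cball 0 1 = cball 0 1,
         inversion a @` oball 0 1 = oball 0 1,
         inversion a @` sphere 0 1 = sphere 0 1
       & forall x : 'rV[R]_d, sphere 0 1 x ->
           inversion a x = x - 2 *: line_proj (x - inv_center a) x])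
  /\
  (forall (r rho : R) (e : 'rV[R]_d),
     0 < r < 1 -> 0 < rho < 1 -> sphere 0 1 e ->
     let a := rho *: e in
     let C := (rho * (r ^+ 2 - 1) / (rho ^+ 2 * r ^+ 2 - 1)) *: e in
     let R0 := r * (rho ^+ 2 - 1) / (rho ^+ 2 * r ^+ 2 - 1) in
     [/\ 0 < R0,
         inversion a @` oball 0 r = oball C R0
       & inversion a @` sphere 0 r = sphere C R0])
  /\
  (forall (c R0 : R) (e : 'rV[R]_d),
     0 < c < 1 -> 0 < R0 < 1 - c -> sphere 0 1 e ->
     let C := c *: e in
     let r := (1 + R0 ^+ 2 - c ^+ 2
               - Num.sqrt (((1 - R0) ^+ 2 - c ^+ 2) * ((1 + R0) ^+ 2 - c ^+ 2)))
              / (2 * R0) in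
     let a := (1 - R0 * r)^-1 *: C in
     [/\ 0 < r, oball 0 1 a /\ a != 0,
         inversion a @` oball C R0 = oball 0 r,
         inversion a @` sphere C R0 = sphere 0 r
       & forall (a' : 'rV[R]_d) (r' : R),
           oball 0 1 a' -> a' != 0 -> 0 < r' ->
           inversion a' @` oball C R0 = oball 0 r' -> a' = a /\ r' = r]).

Proof.
split=> [a a1 a0|].
  split; [exact: inversion_unit_cball | exact: inversion_unit_oball
         | exact: inversion_unit_sphere | exact: inversion_unit_sphereE].
split=> [r rho e r01 p01 se|c t e c01 t01 se C r a].
  exact: inversion_concentric.
have [r01 Er] := inversion_radius_root c01 t01; rewrite -/r in r01 Er.
have t01' : 0 < t < 1 by move: c01 t01 => /andP[? ?] /andP[? ?]; apply/andP; split; lra.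
have /andP[c0 _] := c01; have /andP[r0 _] := r01.
set rho := c / (1 - t * r).
have [p01 cE tE] := (inversion_parametersP rho c0 t01' r01).2 (conj Er erefl).
have aE : a = rho *: e by rewrite /a /C scalerA mulrC.
have [a1 a0] := ray_in_unit_oball p01 se.
have [_ imB imS] := inversion_concentric r01 p01 se.
move: imB imS; rewrite -cE -tE -/C => imB imS.
rewrite aE; split=> //.
- by apply: image_involutive_swap imB; apply: inversionK.
- by apply: image_involutive_swap imS; apply: inversionK.
- move=> a' r'; exact: inversion_to_concentric_uniq.
Qed.
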